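(* Let $X=HFG(P_M,Q_N)$ be a Hadamard fat grid. The minimal degree $\alpha(\mathcal{I}(P_M,Q_N))$ of a generator of the ideal $\mathcal{I}(P_M,Q_N)$ is given by $$\alpha(\mathcal{I}(P_M,Q_N))=\sum_{i=1}^r m_i+\sum_{i=1}^r n_{s-i+1}-r.$$
   Context: Let $\mathbb{K}$ be an algebraically closed field and $S=\mathbb{K}[x_0,x_1,x_2]$. For a homogeneous ideal $0\neq I\subset S$, $\alpha(I)$ is the least degree $d$ such that $I_d\neq 0$. For a point $P\in\mathbb{P}^2$, $I(P)\subset S$ is the ideal generated by all homogeneous polynomials vanishing at $P$; $\Delta_1$ is the union of the coordinate lines $x_i=0$ of $\mathbb{P}^2$. The Hadamard product of points is coordinatewise, $[p_0:p_1:p_2]\star[q_0:q_1:q_2]=[p_0q_0:p_1q_1:p_2q_2]$; for a line $\ell$ and a point $P\notin\Delta_1$, $\ell\star P$ is the line $\{L\star P: L\in\ell\}$. The Hadamard product of ideals $I,J\subset S$ is $I\star J=(I(\mathbf{y})+J(\mathbf{z})+\langle x_i-y_iz_i\mid i=0,1,2\rangle)\cap\mathbb{K}[x_0,x_1,x_2]$, where $I(\mathbf{y})$, $J(\mathbf{z})$ are the images of $I,J$ under $x_i\mapsto y_i$, $x_i\mapsto z_i$. Hadamard fat grid: let $\{P_1,\dots,P_r\}$ and $\{Q_1,\dots,Q_s\}$ be sets of distinct collinear points in $\mathbb{P}^2\setminus\Delta_1$, lying on lines $\ell_P$ and $\ell_Q$ respectively, with positive integer multiplicities $M=\{m_1,\dots,m_r\}$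 and $N=\{n_1,\dots,n_s\}$, where $r\leq s$, $m_1\leq\cdots\leq m_r$ and $n_1\leq\cdots\leq n_s$. Put $I(P_M)=\bigcap_i I(P_i)^{m_i}$, $I(Q_N)=\bigcap_j I(Q_j)^{n_j}$. Assume $P_i\star Q_j\neq P_k\star Q_l$ for all $1\leq i<k\leq r$, $1\leq j<l\leq s$. The set of fat points defined by $I(P_M)\star I(Q_N)$ is the Hadamard fat grid $HFG(P_M,Q_N)$; its ideal is $\mathcal{I}(P_M,Q_N)=\bigcap_{i=1}^r\bigcap_{j=1}^s I(P_i\star Q_j)^{m_i+n_j-1}$. Its support $\{P_i\star Q_j\}$ is a complete intersection of type $(r,s)$, i.e. it consists of $rs$ distinct points, the intersections $(\ell_Q\star P_i)\cap(\ell_P\star Q_j)=\{P_i\star Q_j\}$ of the $r$ distinct lines $\ell_Q\star P_i$ with the $s$ distinct lines $\ell_P\star Q_j$. *)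

(* Defs.v *)
From mathcomp Require Import all_boot all_order all_algebra.
From mathcomp Require Import mpoly.

Set Implicit Arguments.
Unset Strict Implicit.
Unset Printing Implicit Defensive.

Import GRing.Theory.
Local Open Scope ring_scope.

Section Ideals.
Variable R : comNzRingType.
Implicit Types I G : R -> Prop.

(* Ideals are Prop-valued subsets: membership in an ideal given by arbitrary
   generators is not decidable, so the boolean ideals of ring_quotient do not
   apply. *)
Definition ideal_gen G : R -> Prop := fun f =>
  exists (k : nat) (a g : 'I_k -> R),
    (forall i, G (g i)) /\ f = \sum_(i < k) a i * g i.

Definition ideal_pow I (e : nat) : R -> Prop :=
  ideal_gen (fun f => exists g : 'I_e -> R,
    (forall i, I (g i)) /\ f = \prod_(i < e) g i).

End Ideals.

Section Plane.
Variable K : fieldType.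
Implicit Types (P Q X L a : 'rV[K]_3) (A B : 'rV[K]_3 -> Prop).

(* A point of the projective plane is given by a nonzero row vector of
   homogeneous coordinates, and equality of points is [proj_eq].  A subset of
   the plane is a predicate on nonzero row vectors invariant under [proj_eq]. *)
Definition proj_eq P Q : Prop := exists2 c : K, c != 0 & Q = c *: P.

Definition off_coord_lines P : Prop := forall i, P 0 i != 0.

Definition hadamard P Q : 'rV[K]_3 := map2_mx *%R P Q.

(* The line a_0 x_0 + a_1 x_1 + a_2 x_2 = 0, for a != 0. *)
Definition on_line a X : Prop := X != 0 /\ \sum_(i < 3) a 0 i * X 0 i = 0.

Definition line_hadamard a P X : Prop :=
  exists2 L, on_line a L & proj_eq (hadamard L P) X.

Definition same_locus A B : Prop := forall X, A X <-> B X.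

Definition point_ideal P : {mpoly K[3]} -> Prop :=
  ideal_gen (fun f : {mpoly K[3]} =>
    (exists d : nat, f \is d.-homog) /\ f.@[P 0] = 0).

(* The points hadamard (P i) (Q j) form a complete intersection of type (r, s)
   cut out by the r lines lQ * P_i and the s lines lP * Q_j. *)
Definition grid_complete_intersection (r s : nat) (lP lQ : 'rV[K]_3)
    (P : 'I_r -> 'rV[K]_3) (Q : 'I_s -> 'rV[K]_3) : Prop :=
  [/\ (forall i k, i != k ->
         ~ same_locus (line_hadamard lQ (P i)) (line_hadamard lQ (P k))),
      (forall j l, j != l ->
         ~ same_locus (line_hadamard lP (Q j)) (line_hadamard lP (Q l))),
      (forall i j k l, (i, j) != (k, l) ->
         ~ proj_eq (hadamard (P i) (Q j)) (hadamard (P k) (Q l)))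
    & (forall i j X,
         (line_hadamard lQ (P i) X /\ line_hadamard lP (Q j) X)
           <-> proj_eq (hadamard (P i) (Q j)) X)].

(* The exponents are truncated subtractions, exact for positive m i, n j. *)
Definition hfg_ideal (r s : nat) (P : 'I_r -> 'rV[K]_3) (m : 'I_r -> nat)
    (Q : 'I_s -> 'rV[K]_3) (n : 'I_s -> nat) : {mpoly K[3]} -> Prop :=
  fun f => forall i j,
    ideal_pow (point_ideal (hadamard (P i) (Q j))) (m i + n j - 1)%N f.

Definition has_form_of_degree (I : {mpoly K[3]} -> Prop) (d : nat) : Prop :=
  exists f : {mpoly K[3]}, [/\ I f, f \is d.-homog & f != 0].

(* alpha(I) = d; in particular I is nonzero. *)
Definition is_alpha (I : {mpoly K[3]} -> Prop) (d : nat) : Prop :=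
  has_form_of_degree I d /\ (forall e, has_form_of_degree I e -> (d <= e)%N).

End Plane.

(* Main.v *)
Require Import Defs.
From mathcomp Require Import all_boot all_order all_algebra.
From HB Require Import structures.
From mathcomp Require Import fraction mpoly ring zify.

Set Implicit Arguments.
Unset Strict Implicit.
Unset Printing Implicit Defensive.

Import GRing.Theory.
Local Open Scope ring_scope.

(** No point of the grid lies on x_0 = 0, so a form F in the ideal can be replaced
by the polynomial f(x, y) = F(1, x, y), which is nonzero, has degree at most deg F
and vanishes to the same orders.  Keep only the r columns with the largest n_j:
with a_i = m_i - 1 and b_j = n_j, f vanishes to order a_i + b_j on an r x r grid,
and we need deg f >= sum a_i + sum b_j.  Otherwise take the row with the largest
a_i > 0: the orders on it add up to r a_i + sum b_j >= sum a_i + sum b_j > deg f,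
so by Bezout its line divides f; dividing lowers a_i and deg f by one.  When all
a_i vanish use the columns, and when all b_j vanish too the bound is trivial.
A form of the least degree is prod_i H_i^(m_i + c - 1) prod_j V_j^(n_j - c), with
truncated n_j - c, where H_i and V_j are the equations of the rows and columns and
c is the r-th largest n_j. *)

(** * Substitution into multivariate polynomials *)

Lemma rmorph_mmap n (R S T : comNzRingType) (g : {rmorphism S -> T})
    (c : R -> S) (v : 'I_n -> S) (p : {mpoly R[n]}) :
  g (mmap c v p) = mmap (g \o c) (g \o v) p.
Proof.
rewrite /mmap rmorph_sum; apply: eq_bigr => k _; rewrite rmorphM; congr (_ * _).
by rewrite /mmap1 rmorph_prod; apply: eq_bigr => i _; rewrite rmorphXn.
Qed.

Lemma eq_mmap n (R S : comNzRingType) (c c' : R -> S) (v v' : 'I_n -> S)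
    (p : {mpoly R[n]}) :
  c =1 c' -> v =1 v' -> mmap c v p = mmap c' v' p.
Proof.
move=> eqc eqv; rewrite /mmap; apply: eq_bigr => k _.
by rewrite eqc (mmap1_eq _ eqv).
Qed.

Lemma mmap_var n (R : comNzRingType) (p : {mpoly R[n]}) :
  mmap (@mpolyC n R) (fun i => 'X_i) p = p.
Proof.
rewrite [RHS]mpolyE /mmap; apply: eq_bigr => k _.
by rewrite mmap1_id mul_mpolyC.
Qed.

Lemma mmapXU n (R S : comNzRingType) (c : {rmorphism R -> S}) (v : 'I_n -> S) i :
  mmap c v 'X_i = v i.
Proof. by rewrite mmapX mmap1U. Qed.

Lemma mmap_homog n (R S : comNzRingType) (c : R -> S) (v : 'I_n -> S) (u : S)
    (d : nat) (p : {mpoly R[n]}) :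
  p \is d.-homog -> mmap c (fun i => u * v i) p = u ^+ d * mmap c v p.
Proof.
move=> /dhomogP hp; rewrite /mmap mulr_sumr; apply: eq_big_seq => k /hp /= <-.
rewrite mulrCA; congr (_ * _); rewrite /mmap1 mdegE -prodrXr -big_split /=.
by apply: eq_bigr => i _; rewrite exprMn.
Qed.

Lemma size_mmap n (R : comNzRingType) (S : idomainType) (c : R -> S)
    (v : 'I_n -> {poly S}) (p : {mpoly R[n]}) :
  (forall i, size (v i) <= 2)%N ->
  (size (mmap (polyC \o c) v p) <= msize p)%N.
Proof.
move=> hv; apply: leq_trans (size_sum _ _ _) _; rewrite [msize _]msizeE.
elim: (msupp p) => [|k s IH]; first by rewrite !big_nil.
rewrite !big_cons geq_max !leq_max; apply/andP; split; last by rewrite IH orbT.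
apply/orP; left; rewrite /= mul_polyC (leq_trans (size_scale_leq _ _)) //.
rewrite /mmap1 mdegE; elim/big_rec2: _ => [|i y1 y2 _ h]; first by rewrite size_poly1.
apply: leq_trans (size_polyMleq _ _) _.
have: (size (v i ^+ k i) <= (k i).+1)%N.
  apply: leq_trans (size_poly_exp_leq _ _) _; rewrite ltnS.
  by have:= hv i; case: (size _) => [|[|[|]]] //= _; rewrite ?mul0n ?mul1n.
move=> h1; have := leq_add h1 h; rewrite addSn addnS; case: (_ + _)%N => //=.
Qed.

(** * Order of vanishing at a point *)

Section Order.
Variables (n : nat) (K : fieldType).
Implicit Types (q : 'I_n -> K) (f g : {mpoly K[n]}).

(* f(q + t Y) as a polynomial in t over K[Y]. *)
Definition taylor q : {mpoly K[n]} -> {poly {mpoly K[n]}} :=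
  mmap (polyC \o @mpolyC n K) (fun i => (q i)%:MP%:P + ('X_i)%:P * 'X).

HB.instance Definition _ q := GRing.RMorphism.on (taylor q).

(** The coefficient of t^k in f(q + tY) is the part of f of degree k at q. Since Y is a vector of
    indeterminates, divisibility by t^e captures the multiplicity in every characteristic, without
    derivatives. *)
Definition order_ge q (e : nat) f : bool := 'X^e %| taylor q f.

Lemma horner_taylor q f : (taylor q f).[0] = f.@[q]%:MP.
Proof.
rewrite -horner_evalE rmorph_mmap [f.@[q]]/(meval _ _) rmorph_mmap.
by apply: eq_mmap => i /=; rewrite horner_evalE !hornerE.
Qed.

(** The expansion of f has constant term f(q), so it is coprime to t^e when f does not vanish at
    q. *)
Lemma order_ge_mulr q e f g : f.@[q] != 0 -> order_ge q e (f * g) -> order_ge q e g.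
Proof.
move=> fq; rewrite /order_ge rmorphM /= Gauss_dvdpr //.
by rewrite coprimep_expl // coprimep_sym coprimepX rootE horner_taylor mpolyC_eq0.
Qed.

End Order.

(** * Equations of lines in the affine plane *)

Section AffineLines.
Variable K : fieldType.
Implicit Types (q : 'I_2 -> K) (f g : {mpoly K[2]}) (a : 'rV[K]_3).

Definition affine a : {mpoly K[2]} :=
  (a 0 ord0)%:MP + \sum_(i < 2) (a 0 (lift ord0 i))%:MP * 'X_i.

Definition nonconstant a : Prop := exists i : 'I_2, a 0 (lift ord0 i) != 0.

Lemma nonconstant_dual a : nonconstant a ->
  exists b : 'I_2 -> K, \sum_(i < 2) a 0 (lift ord0 i) * b i = 1.
Proof.
case=> i ai; exists (fun j => if j == i then (a 0 (lift ord0 i))^-1 else 0).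
rewrite (bigD1 i) //= eqxx divff // big1 ?addr0 // => j /negbTE ->.
by rewrite mulr0.
Qed.

Lemma linear_part_neq0 a : nonconstant a ->
  \sum_(i < 2) (a 0 (lift ord0 i))%:MP * 'X_i != 0 :> {mpoly K[2]}.
Proof.
case/nonconstant_dual=> b hb; apply: contra_neq (oner_neq0 K) => h0.
have := congr1 (meval b) h0; rewrite meval0 raddf_sum /= => <-; rewrite -hb.
by apply: eq_bigr => i _; rewrite mevalM mevalC mevalXU.
Qed.

Lemma meval_affine a q :
  (affine a).@[q] = a 0 ord0 + \sum_(i < 2) a 0 (lift ord0 i) * q i.
Proof.
rewrite mevalD mevalC raddf_sum /=; congr (_ + _).
by apply: eq_bigr => i _; rewrite mevalM mevalC mevalXU.
Qed.

Lemma taylor_affine a q : taylor q (affine a) =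
  (affine a).@[q]%:MP%:P
  + (\sum_(i < 2) (a 0 (lift ord0 i))%:MP * 'X_i)%:P * 'X.
Proof.
rewrite meval_affine /affine !rmorphD !rmorph_sum /= [taylor _ _%:MP]mmapC /=.
rewrite mulr_suml -addrA -big_split; congr (_ + _).
apply: eq_bigr => i _; rewrite rmorphM /= [taylor _ _%:MP]mmapC [taylor _ 'X_i]mmapXU /=.
by rewrite !rmorphM /= mulrDr mulrA.
Qed.

(** At a point of the line, the expansion of its equation is t times a nonzero linear form in Y, so
    exactly one factor t cancels. *)
Lemma order_ge_mulr_affine a q e g : nonconstant a -> (affine a).@[q] = 0 ->
  order_ge q e (affine a * g) -> order_ge q e.-1 g.
Proof.
move=> ha hq; rewrite /order_ge rmorphM /= taylor_affine hq !rmorph0 add0r.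
case: e => [|e]; first by rewrite expr0 !dvd1p.
by rewrite exprSr mulrAC dvdp_mul2r ?polyX_eq0 // mul_polyC dvdpZr // linear_part_neq0.
Qed.

Lemma affine_neq0 a : nonconstant a -> affine a != 0.
Proof.
move=> ha; apply: contraNneq (linear_part_neq0 ha) => h0.
have := taylor_affine a (fun=> 0); rewrite h0 !rmorph0 add0r /= => /esym/eqP.
by rewrite mulf_eq0 polyX_eq0 orbF polyC_eq0.
Qed.

Lemma msize_affine a : nonconstant a -> msize (affine a) = 2%N.
Proof.
move=> [i ai]; apply/eqP; rewrite eqn_leq; apply/andP; split.
  apply: leq_trans (msizeD_le _ _) _; rewrite geq_max msizeC; apply/andP; split.
    by case: (_ == _).
  apply: leq_trans (msize_sum _ _ _) _; apply/bigmax_leqP => j _.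
  by rewrite mul_mpolyC (leq_trans (msizeZ_le _ _)) // msizeX mdeg1.
have: affine a \notin [pred f | (msize f <= 1)%N].
  apply: contra ai; rewrite inE => /msize1_polyC h; move/(congr1 (mcoeff U_(i))): h.
  rewrite mcoeffC mcoeffD mcoeffC mnm1_eq0 !mulr0 add0r raddf_sum /= (bigD1 i) //=.
  rewrite mul_mpolyC mcoeffZ mcoeffX eqxx mulr1 big1 ?addr0 => [/eqP //|j ji].
  by rewrite mul_mpolyC mcoeffZ mcoeffX eq_mnm1 (negbTE ji) mulr0.
by rewrite inE -ltnNge.
Qed.

End AffineLines.

(** * Bezout for a line and a curve *)

Lemma mpoly_shift n (R : comNzRingType) (h : {mpoly R[n]}) (b : 'I_n -> R)
    (f : {mpoly R[n]}) :
  exists g, f = mmap (@mpolyC n R) (fun i => 'X_i - h * (b i)%:MP) f + h * g.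
Proof.
(* Congruence of f and [s f] modulo h is stable under sums and products, so constants and variables
   suffice. *)
set s := mmap _ _; pose D f := exists g, f = s f + h * g; rewrite -/(D f).
have DD f1 f2 : D f1 -> D f2 -> D (f1 + f2).
  move=> [g1 e1] [g2 e2]; exists (g1 + g2).
  by rewrite /s rmorphD /= -/s {1}e1 {1}e2; ring.
have DM f1 f2 : D f1 -> D f2 -> D (f1 * f2).
  move=> [g1 e1] [g2 e2]; exists (g1 * f2 + s f1 * g2).
  by rewrite /s rmorphM /= -/s {1}e1 mulrDl {1}e2; ring.
have DC c : D c%:MP by exists 0; rewrite /s mmapC mulr0 addr0.
elim/mpolyind: f => [|c m f _ _ Df]; first by rewrite -mpolyC0.
apply: (DD _ _ _ Df); rewrite -mul_mpolyC; apply: (DM _ _ (DC c)).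
rewrite mpolyXE_id; apply: big_ind => [|f1 f2|i _]; [by rewrite -mpolyC1 | exact: DM |].
elim: (m i) => [|k IH]; first by rewrite expr0 -mpolyC1.
rewrite exprS; apply: (DM _ _ _ IH); exists (b i)%:MP.
by rewrite /s mmapXU subrK.
Qed.

Lemma I2P (P : 'I_2 -> Prop) : P ord0 -> P (lift ord0 ord0) -> forall i, P i.
Proof. by move=> P0 P1 i; case: (unliftP ord0 i) => [j ->|-> //]; rewrite ord1. Qed.

Section Bezout.
Variable K : fieldType.
Implicit Types (q : 'I_2 -> K) (f g : {mpoly K[2]}) (a : 'rV[K]_3) (b : 'I_2 -> K).

(** The vector (a_2, - a_1), along which the linear part of the equation vanishes. *)
Definition direction a (i : 'I_2) : K :=
  if i == ord0 then a 0 (lift ord0 (lift ord0 ord0)) else - a 0 (lift ord0 ord0).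

(* If [b] satisfies a_1 b_1 + a_2 b_2 = 1, then - a_0 b is a point of the line,
   and [line_coord] is the parameter of the projection along [b] onto it. *)
Definition line_param a b i : {poly K} :=
  (- a 0 ord0 * b i)%:P + (direction a i)%:P * 'X.

Definition line_coord (S : pzRingType) (c : K -> S) b (x : 'I_2 -> S) : S :=
  c (b (lift ord0 ord0)) * x ord0 - c (b ord0) * x (lift ord0 ord0).

(** Both sides are the projection of x onto the line along b. The ring S is K for actual points and
    K[X_0, X_1] for the generic point. *)
Lemma line_param_coord (S : comNzRingType) (c : {rmorphism K -> S}) a b
    (x : 'I_2 -> S) i :
  \sum_(i < 2) a 0 (lift ord0 i) * b i = 1 ->
  c (- a 0 ord0 * b i) + c (direction a i) * line_coord c b x =
  x i - (c (a 0 ord0) + \sum_(i < 2) c (a 0 (lift ord0 i)) * x i) * c (b i).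
Proof.
rewrite !big_ord_recl !big_ord0 !addr0 /line_coord.
move/(congr1 c); rewrite rmorphD !rmorphM rmorph1 /= => /(canRL (addrK _)) hb.
by elim/I2P: i; rewrite /direction /= !(rmorphM, rmorphN) /=; ring: hb.
Qed.

(** Modulo the equation of the line, f equals its composite with the projection along b. That
    composite is the restriction of f to the line evaluated at [line_coord], hence zero. *)
Lemma vanish_on_line_dvd a b f :
  \sum_(i < 2) a 0 (lift ord0 i) * b i = 1 ->
  mmap polyC (line_param a b) f = 0 -> exists g, f = affine a * g.
Proof.
move=> hb f0; have [g {1}->] := mpoly_shift (affine a) b f; exists g.
rewrite -[RHS]add0r; congr (_ + _).
have hcomm : commr_rmorph (@mpolyC 2 K : K -> {mpoly K[2]})
    (line_coord (@mpolyC 2 K) b (fun i => 'X_i)) by move=> x; apply: mulrC.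
have := congr1 (horner_morph hcomm) f0; rewrite rmorph0 rmorph_mmap => <-.
apply: eq_mmap => [x|i] /=; first by rewrite horner_morphC.
rewrite /line_param rmorphD /= [horner_morph _ (_ * 'X)]rmorphM /= !horner_morphC.
by rewrite horner_morphX line_param_coord.
Qed.

Lemma order_ge_on_line a b q e f :
  \sum_(i < 2) a 0 (lift ord0 i) * b i = 1 -> (affine a).@[q] = 0 ->
  order_ge q e f ->
  ('X - (line_coord idfun b q)%:P) ^+ e %| mmap polyC (line_param a b) f.
Proof.
(* Since t^e is monic, pseudo-divisibility over K[Y] gives a true quotient. *)
move=> hb hq /(Pdiv.IdomainMonic.dvdpP (monicXn _ _)) [g hg].
set t := line_coord _ _ _.
(* Sending Y to the direction of the line and t to ['X - t%:P] turns q + tY into the parametrized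
   line and t^e into the required power. *)
have hcomm : commr_rmorph (polyC \o meval (direction a) : {mpoly K[2]} -> {poly K})
    ('X - t%:P) by move=> x; apply: mulrC.
have -> : mmap polyC (line_param a b) f = horner_morph hcomm (taylor q f).
  rewrite rmorph_mmap; apply: eq_mmap => [x|i] /=.
    by rewrite horner_morphC /= mevalC.
  rewrite rmorphD rmorphM /= !horner_morphC horner_morphX /= mevalC mevalXU.
  have := @line_param_coord K idfun a b q i hb.
  rewrite -meval_affine hq mul0r subr0 /= -/t => <-.
  by rewrite /line_param rmorphD rmorphM /=; ring.
rewrite hg rmorphM rmorphXn /= horner_morphX; exact: dvdp_mulIr.
Qed.

Lemma dvdp_prod_XsubC_exp (J : finType) (t : J -> K) (e : J -> nat) (u : {poly K}) :
  injective t -> (forall j, ('X - (t j)%:P) ^+ e j %| u) ->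
  \prod_j ('X - (t j)%:P) ^+ e j %| u.
Proof.
move=> tI hu; elim: (index_enum J) (index_enum_uniq J) => [|j s IH] /=.
  by rewrite big_nil dvd1p.
case/andP=> js /IH hs; rewrite big_cons Gauss_dvdp ?hu //.
rewrite big_seq; apply: (big_ind (coprimep _)) => [|p1 p2|l ls]; first exact: coprimep1.
  by rewrite coprimepMr => -> ->.
rewrite coprimep_expl // coprimep_expr // coprimep_XsubC2 // subr_eq0.
by apply: contraNneq js => /tI <-.
Qed.

(** The restriction of f to the line has degree less than the sum of the e_j, since [msize] is the
    degree plus one. It is divisible by a product of that degree, so it vanishes. *)
Lemma affine_dvd (J : finType) a (q : J -> 'I_2 -> K) (e : J -> nat) f :
  nonconstant a -> (forall j, (affine a).@[q j] = 0) ->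
  (forall j l, q j =1 q l -> j = l) ->
  (forall j, order_ge (q j) (e j) f) ->
  (msize f <= \sum_j e j)%N -> exists g, f = affine a * g.
Proof.
move=> /nonconstant_dual[b hb] hq qI hf hsize; apply: (vanish_on_line_dvd hb).
apply/eqP; apply: contraLR hsize => u0; rewrite -ltnNge.
(* A point of the line is recovered from its parameter. *)
have tI : injective (fun j => line_coord idfun b (q j)).
  move=> j l ejl; apply: qI => i.
  have := @line_param_coord K idfun a b (q j) i hb.
  have := @line_param_coord K idfun a b (q l) i hb.
  by rewrite -!meval_affine !hq /= -ejl !mul0r !subr0 => <- <-.
have hdvd j := order_ge_on_line hb (hq j) (hf j).
have := dvdp_leq u0 (dvdp_prod_XsubC_exp tI hdvd).
rewrite size_prod => [|j _]; last by rewrite expf_neq0 // polyXsubC_eq0.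
under eq_bigr => j _ do rewrite size_exp_XsubC -addn1.
rewrite big_split /= sum1_card -addSn addnK => hs.
apply: leq_trans hs (leq_trans (size_mmap idfun _ _) (leqnn _)) => i.
apply: leq_trans (size_polyD _ _) _; rewrite geq_max mul_polyC.
rewrite (leq_trans (size_polyC_leq1 _)) //=.
by rewrite (leq_trans (size_scale_leq _ _)) // size_polyX.
Qed.

End Bezout.

(** * Degree bound on a square grid *)

Section Grid.
Variables (K : fieldType) (r : nat).
Implicit Types (h v : 'I_r -> 'rV[K]_3) (q : 'I_r -> 'I_r -> 'I_2 -> K).
Implicit Types (a b : 'I_r -> nat).

(** The line [h i] contains the points of row i and no other grid point; transposing q gives the
    same condition for columns. *)
Definition transversal_lines h q : Prop :=
  (forall i, nonconstant (h i)) /\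
  (forall i k j, ((affine (h i)).@[q k j] == 0) = (i == k)).

Lemma grid_row_dvd h v q a b (i : 'I_r) (f : {mpoly K[2]}) :
  transversal_lines h q -> transversal_lines v (fun j i => q i j) ->
  (forall k j, order_ge (q k j) (a k + b j) f) ->
  (forall k, a k <= a i)%N -> (0 < a i)%N ->
  (msize f <= \sum_k a k + \sum_j b j)%N ->
  exists2 g, f = affine (h i) * g &
    forall k j, order_ge (q k j) (a k - (k == i) + b j) g.
Proof.
move=> [hn hq] [vn vq] hf amax ai hsize.
have [|j|j l e|j||g fg] := @affine_dvd K _ (h i) (q i) (fun j => a i + b j)%N f.
- exact: hn.
- by apply/eqP; rewrite hq.
(* Points of a row are separated by the columns: if the points j and l coincide, then column l
   passes through point j. *)
- by apply/eqP; rewrite eq_sym -(vq l j i) (meval_eq _ e) vq.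
- exact: hf.
- apply: leq_trans hsize _; rewrite big_split leq_add2r.
  by apply: leq_sum => k _; apply: amax.
exists g => // k j; have := hf k j; rewrite fg; case: eqVneq => [->|ki].
  have hi : (affine (h i)).@[q i j] = 0 by apply/eqP; rewrite hq.
  move/(order_ge_mulr_affine (hn i) hi).
  by rewrite -subn1 addnBAC.
by rewrite subn0; apply: order_ge_mulr; rewrite hq eq_sym.
Qed.

Lemma grid_degree_gt h v q a b (f : {mpoly K[2]}) :
  transversal_lines h q -> transversal_lines v (fun j i => q i j) ->
  f != 0 -> (forall i j, order_ge (q i j) (a i + b j) f) ->
  (\sum_i a i + \sum_j b j < msize f)%N.
Proof.
move eN : (\sum_i a i + \sum_j b j)%N => N.
elim: N h v q a b f eN => [|N IH] h v q a b f eN hh hv f0 hf.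
  by rewrite lt0n msize_poly_eq0.
(* The total is positive, so some a_i or some b_j is; transposing the grid exchanges the two
   cases. *)
wlog [i0 ai0] : h v q a b eN hh hv hf / exists i, (0 < a i)%N.
  move=> W; have [[i ai]|/existsPn a0] := altP (@existsP _ (fun i => 0 < a i)%N).
    by apply: (W h v q a b) => //; exists i.
  have [[j bj]|/existsPn b0] := altP (@existsP _ (fun i => 0 < b i)%N).
    apply: (W v h (fun j i => q i j) b a) => //; first by rewrite addnC.
      by move=> *; rewrite addnC.
    by exists j.
  by move: eN; rewrite !big1 // => k _; apply/eqP; rewrite -leqn0 leqNgt.
rewrite ltnNge; apply/negP => hsize.
have [i _ amax] := arg_maxnP a (erefl : xpredT i0).
have ai : (0 < a i)%N by apply: leq_trans ai0 (amax _ _).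
have [||g fg hg] := grid_row_dvd hh hv hf _ ai.
- by move=> k; apply: amax.
- by rewrite eN.
have g0 : g != 0 by apply: contraNneq f0 => g0; rewrite fg g0 mulr0.
have eN' : (\sum_k (a k - (k == i)) + \sum_j b j)%N = N.
  move: eN; rewrite (bigD1 i) //= [in X in _ -> X](bigD1 i) //= eqxx.
  have -> : (\sum_(k | k != i) (a k - (k == i)) = \sum_(k | k != i) a k)%N.
    by apply: eq_bigr => k /negbTE ->; rewrite subn0.
  by case: (a i) ai => // x _; rewrite subn1 /= !addSn => -[].
have := IH h v q _ b g eN' hh hv g0 hg.
(* Dividing by the line lowers [msize] by exactly one, so g contradicts the induction hypothesis. *)
have [hn _] := hh; move: hsize; rewrite fg msizeM ?affine_neq0 // msize_affine //=.
by rewrite ltnS => hle hlt; move: (leq_ltn_trans hle hlt); rewrite ltnn.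
Qed.

End Grid.

(** * Passage to the chart x_0 = 1 *)

Section Dehomogenization.
Variable K : fieldType.
Implicit Types (F G : {mpoly K[3]}) (p : 'rV[K]_3) (a : 'rV[K]_3).

Definition chart_var (i : 'I_3) : {mpoly K[2]} :=
  if unlift ord0 i is Some j then 'X_j else 1.

Definition dehom : {mpoly K[3]} -> {mpoly K[2]} := mmap (@mpolyC 2 K) chart_var.

HB.instance Definition _ := GRing.RMorphism.on dehom.

Definition chart p (j : 'I_2) : K := p 0 (lift ord0 j) / p 0 ord0.

(** In the fraction field, F is x_0^d times its dehomogenization evaluated at x_1/x_0 and
    x_2/x_0. *)
Lemma dehom_neq0 d F : F \is d.-homog -> F != 0 -> dehom F != 0.
Proof.
move=> hF; apply: contra_neq => F0.
pose x i : {fraction {mpoly K[3]}} := tofrac 'X_i.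
have x0 : x ord0 != 0.
  rewrite /x tofrac_eq0; apply/eqP => /(congr1 (mcoeff U_(ord0))).
  by rewrite mcoeffX eqxx mcoeff0 => /eqP; rewrite oner_eq0.
pose c : K -> {fraction {mpoly K[3]}} := @tofrac {mpoly K[3]} \o @mpolyC 3 K.
have F'0 : mmap c (fun i => x i / x ord0) F = 0.
  have <- : mmap c (fun j => x (lift ord0 j) / x ord0) (dehom F) = 0.
    by rewrite F0 raddf0.
  rewrite rmorph_mmap; apply: eq_mmap => [y|i] /=; first by rewrite mmapC.
  rewrite /chart_var; case: unliftP => [j ->|->]; first by rewrite mmapXU.
  by rewrite rmorph1 divff.
apply/eqP; rewrite -tofrac_eq0 -[F in tofrac F]mmap_var rmorph_mmap; apply/eqP.
transitivity (mmap c (fun i => x ord0 * (x i / x ord0)) F).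
  by apply: eq_mmap => // i /=; rewrite mulrCA divff // mulr1.
by rewrite (mmap_homog _ _ _ hF) F'0 mulr0.
Qed.

Lemma msize_dehom d F : F \is d.-homog -> (msize (dehom F) <= d.+1)%N.
Proof.
move/dhomogP => hF; apply: leq_trans (msize_sum _ _ _) _.
apply/bigmax_leqP_seq => k /hF /= <- _.
rewrite mul_mpolyC (leq_trans (msizeZ_le _ _)) // /mmap1 big_ord_recl /=.
rewrite {1}/chart_var unlift_none expr1n mul1r.
under eq_bigr => j _ do rewrite /chart_var liftK.
pose k' := [multinom k (lift ord0 j) | j < 2].
have -> : \prod_(j < 2) 'X_j ^+ k (lift ord0 j) = 'X_[k'] :> {mpoly K[2]}.
  by rewrite mpolyXE_id; apply: eq_bigr => j _; rewrite mnmE.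
rewrite msizeX ltnS !mdegE [in X in (_ <= X)%N]big_ord_recl.
by under eq_bigr => j _ do rewrite mnmE; apply: leq_addl.
Qed.

Lemma meval_dehom d F p : p 0 ord0 != 0 -> F \is d.-homog ->
  (dehom F).@[chart p] = (p 0 ord0)^-1 ^+ d * F.@[p 0].
Proof.
move=> p0 hF; rewrite -(mmap_homog _ _ _ hF) [LHS]rmorph_mmap.
apply: eq_mmap => [x|i] /=; first by rewrite mevalC.
rewrite /chart_var; case: unliftP => [j ->|->]; first by rewrite mevalXU mulrC.
by rewrite meval1 mulVf.
Qed.

(** A generator of the point ideal dehomogenizes to a polynomial vanishing at the chart point, whose
    expansion is divisible by t; a product of e elements of the ideal then gives t^e. *)
Lemma order_ge_dehom p e F : p 0 ord0 != 0 ->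
  ideal_pow (point_ideal p) e F -> order_ge (chart p) e (dehom F).
Proof.
move=> p0 [k [a [g [hg ->]]]]; rewrite /order_ge.
(* The composite is packaged as a single ring morphism, to be pushed through the nested sums and
   products. *)
have [T TE] : exists T : {rmorphism {mpoly K[3]} -> {poly {mpoly K[2]}}},
    forall G, taylor (chart p) (dehom G) = T G.
  by exists (taylor (chart p) \o dehom).
rewrite TE rmorph_sum; apply: (big_ind (dvdp 'X^e)) => [|x y|i _].
- exact: dvdp0.
- exact: dvdp_add.
have [u [hu ->]] := hg i; rewrite rmorphM dvdp_mull // rmorph_prod.
rewrite -[X in 'X^X]card_ord -prodr_const.
elim/big_rec2: _ => [|j y1 y2 _ IH]; first exact: dvdpp.
apply: dvdp_mul IH; have [k' [a' [g' [hg' ->]]]] := hu j.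
rewrite rmorph_sum; apply: (big_ind (dvdp 'X)) => [|x y|l _].
- exact: dvdp0.
- exact: dvdp_add.
have [[d hd] g'p] := hg' l; rewrite rmorphM dvdp_mull // -TE.
rewrite -['X]subr0 dvdp_XsubCl rootE horner_taylor.
by rewrite (meval_dehom p0 hd) g'p mulr0.
Qed.

Lemma meval_affine_chart a p : p 0 ord0 != 0 ->
  ((affine a).@[chart p] == 0) = (\sum_(i < 3) a 0 i * p 0 i == 0).
Proof.
move=> p0; rewrite meval_affine [in RHS]big_ord_recl.
rewrite -[LHS](inj_eq (mulIf p0)) mul0r mulrDl big_distrl.
congr (_ + _ == _); apply: eq_bigr => i _.
by rewrite /= /chart -mulrA divfK.
Qed.

(** Only the line x_0 = 0 has a constant equation in the chart, and it misses p. *)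
Lemma line_nonconstant a p : a != 0 -> p 0 ord0 != 0 ->
  \sum_(i < 3) a 0 i * p 0 i = 0 -> nonconstant a.
Proof.
move=> a0 p0 ap; apply/existsP; apply: contra_neqT a0 => /existsPn az.
have az' i : a 0 (lift ord0 i) = 0 by apply/eqP; rewrite -[_ == _]negbK az.
apply/rowP => i; rewrite mxE; case: (unliftP ord0 i) => [j ->//|->].
move: ap; rewrite big_ord_recl big1 ?addr0 => [/eqP|j _]; last by rewrite az' mul0r.
by rewrite mulf_eq0 (negbTE p0) orbF => /eqP.
Qed.

Definition linear_form a : {mpoly K[3]} := \sum_(i < 3) (a 0 i)%:MP * 'X_i.

Lemma linear_form_homog a : linear_form a \is 1.-homog.
Proof.
by apply: rpred_sum => i _; rewrite mul_mpolyC; apply: dhomogZ; rewrite dhomogX /= mdeg1.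
Qed.

Lemma meval_linear_form a p : (linear_form a).@[p 0] = \sum_(i < 3) a 0 i * p 0 i.
Proof.
by rewrite raddf_sum /=; apply: eq_bigr => i _; rewrite mevalM mevalC mevalXU.
Qed.

Lemma linear_form_neq0 a : a != 0 -> linear_form a != 0.
Proof.
apply: contra_neq => h0; apply/rowP => i; rewrite mxE.
have := meval_linear_form a (delta_mx 0 i); rewrite h0 meval0 (bigD1 i) //=.
rewrite mxE !eqxx mulr1 big1 ?addr0 => [->//|j /negbTE ji].
by rewrite mxE ji mulr0.
Qed.

Lemma linear_form_point_ideal a p :
  \sum_(i < 3) a 0 i * p 0 i = 0 -> point_ideal p (linear_form a).
Proof.
move=> ap; exists 1%N, (fun=> 1), (fun=> linear_form a); split=> [_|].
  by split; [exists 1%N; apply: linear_form_homog | rewrite meval_linear_form].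
by rewrite big_ord1 mul1r.
Qed.

End Dehomogenization.

(** * Lines of the Hadamard grid and the form of least degree *)

Lemma ideal_pow_mul (R : comNzRingType) (I : R -> Prop) (x y c : R) (k l e : nat) :
  I x -> I y -> (e <= k + l)%N -> ideal_pow I e (c * (x ^+ k * y ^+ l)).
Proof.
(* The e factors are as many x as possible, then copies of y; all surplus powers go into the
   coefficient. *)
move=> Ix Iy le_e; pose k' := minn k e; pose l' := (e - k')%N.
have ek : e = (k' + l')%N by rewrite subnKC // geq_minr.
have hk : (k' <= k)%N by apply: geq_minl.
have hl : (l' <= l)%N by rewrite /l' /k'; lia.
exists 1%N, (fun=> c * (x ^+ (k - k') * y ^+ (l - l'))), (fun=> x ^+ k' * y ^+ l').
split=> [_|]; last first.
  by rewrite big_ord1 -{1}(subnK hk) -{1}(subnK hl) !exprD; ring.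
rewrite ek; exists (fun i => if split i is inl _ then x else y).
split=> [i|]; first by case: (split i).
rewrite big_split_ord /=; congr (_ * _).
  under eq_bigr => i _ do rewrite (unsplitK (inl i)).
  by rewrite prodr_const card_ord.
under eq_bigr => i _ do rewrite (unsplitK (inr i)).
by rewrite prodr_const card_ord.
Qed.

Section HadamardGrid.
Variable K : fieldType.
Implicit Types (l p L X : 'rV[K]_3).

(* The equation of the line l * p, on which L * p lies exactly when L lies on l. *)
Definition hadamard_line l p : 'rV[K]_3 := map2_mx (fun x y => x / y) l p.

Lemma line_hadamardI l p X : off_coord_lines p -> off_coord_lines X ->
  (* The witness [hadamard_line X p] is used here as a point, the coordinatewise quotient X / p. *)
  \sum_(i < 3) hadamard_line l p 0 i * X 0 i = 0 -> line_hadamard l p X.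
Proof.
move=> hp hX h0; exists (hadamard_line X p); last first.
  exists 1; rewrite ?oner_neq0 // scale1r; apply/rowP => i.
  by rewrite !mxE divfK.
split.
  apply/eqP => /rowP /(_ ord0) /eqP; rewrite !mxE mulf_eq0 invr_eq0.
  by rewrite (negbTE (hX _)) (negbTE (hp _)).
by apply: etrans h0; apply: eq_bigr => i _; rewrite !mxE mulrA mulrAC.
Qed.

Lemma hadamard_line_on l p L : off_coord_lines p -> on_line l L ->
  \sum_(i < 3) hadamard_line l p 0 i * hadamard p L 0 i = 0.
Proof.
move=> hp [_ h0]; apply: etrans h0; apply: eq_bigr => i _.
by rewrite !mxE mulrA divfK.
Qed.

Lemma hadamardC p L : hadamard p L = hadamard L p.
Proof. by apply/rowP => i; rewrite !mxE mulrC. Qed.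

Lemma hadamard_off p L :
  off_coord_lines p -> off_coord_lines L -> off_coord_lines (hadamard p L).
Proof. by move=> hp hL i; rewrite mxE mulf_neq0. Qed.

Lemma hadamard_line_neq0 l p : l != 0 -> off_coord_lines p -> hadamard_line l p != 0.
Proof.
move=> l0 hp; apply: contra_neq l0 => /rowP h0; apply/rowP => i.
move: (h0 i); rewrite !mxE => /eqP; rewrite mulf_eq0 invr_eq0 (negbTE (hp i)) orbF.
by move/eqP.
Qed.

(** If row line i passed through the grid point (k, j), that point would lie on row line i and
    column line j, hence be the grid point (i, j). *)
Lemma hadamard_transversal (r : nat) (lP lQ : 'rV[K]_3) (P Q : 'I_r -> 'rV[K]_3) :
  lQ != 0 ->
  (forall i, off_coord_lines (P i)) -> (forall j, off_coord_lines (Q j)) ->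
  (forall i, on_line lP (P i)) -> (forall j, on_line lQ (Q j)) ->
  (forall i j X,
     line_hadamard lQ (P i) X /\ line_hadamard lP (Q j) X ->
     proj_eq (hadamard (P i) (Q j)) X) ->
  (forall i k j, i != k ->
     ~ proj_eq (hadamard (P i) (Q j)) (hadamard (P k) (Q j))) ->
  transversal_lines (fun i => hadamard_line lQ (P i))
    (fun i j => chart (hadamard (P i) (Q j))).
Proof.
move=> lQ0 hP hQ hlP hlQ hX hd.
have hPQ i j : off_coord_lines (hadamard (P i) (Q j)) by apply: hadamard_off.
split=> [i|i k j].
  by apply: (line_nonconstant (hadamard_line_neq0 lQ0 (hP i)) (hPQ i i ord0));
    apply: hadamard_line_on.
rewrite meval_affine_chart; last exact: hPQ.
case: (eqVneq i k) => [<-|ik]; first by apply/eqP; apply: hadamard_line_on.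
apply/negbTE/eqP => h0; apply: (hd i k j ik); apply: hX; split.
  exact: line_hadamardI.
apply: line_hadamardI => //; rewrite hadamardC; exact: hadamard_line_on.
Qed.

End HadamardGrid.

Lemma dhomog_prod_exp n (R : comNzRingType) (I : finType) (f : I -> {mpoly R[n]})
    (e : I -> nat) :
  (forall i, f i \is 1.-homog) -> \prod_i f i ^+ e i \is (\sum_i e i).-homog.
Proof.
move=> hf; elim/big_rec2: _ => [|i d p _ hp]; first exact: dhomog1.
by apply: dhomogM hp; rewrite -[X in X.-homog]mul1n; apply: dhomogMn.
Qed.

Lemma sum_largest (r s : nat) (hr : (0 < r)%N) (hrs : (r <= s)%N)
    (m : 'I_r -> nat) (n : 'I_s -> nat) :
  (forall i, 0 < m i)%N -> (forall j, 0 < n j)%N ->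
  (forall j l : 'I_s, (j <= l)%N -> (n j <= n l)%N) ->
  exists2 c, (0 < c)%N &
  (\sum_i (m i + c - 1) + \sum_j (n j - c) =
   \sum_(i < r) m i + \sum_(i < r) n (rev_ord (widen_ord hrs i)) - r)%N.
Proof.
case: r hr hrs m => // r _ hrs m m0 n0 nmono.
pose top i := n (rev_ord (widen_ord hrs i)).
have [k es] : exists k, (r.+1 + k)%N = s by exists (s - r.+1)%N; rewrite subnKC.
case: s / es in n hrs n0 nmono top *.
have topE i : top i = n (rev_ord (lshift k i)) by congr (n (rev_ord _)); apply: val_inj.
have le_top i : (top ord_max <= top i)%N.
  by apply: nmono => /=; have := ltn_ord i; lia.
(* The constant c is the r-th largest n_j. *)
exists (top ord_max); first exact: n0.
(* In reversed order the first r columns carry the largest n_j; the others have n_j at most c, so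
   their truncated differences vanish. In the remaining terms c cancels. *)
rewrite [X in (_ + X)%N](reindex_inj rev_ord_inj) big_split_ord /=.
rewrite [X in (_ + (_ + X))%N]big1 ?addn0 => [|j _]; last first.
  by apply/eqP; rewrite subn_eq0 topE; apply: nmono => /=; lia.
rewrite -!big_split /= -[X in _ = (_ - X)%N](card_ord r.+1) -sum1_card -sumnB.
  apply: eq_bigr => i _; rewrite -topE -/(top i).
  by have := m0 i; have := le_top i; lia.
by move=> i _; have := m0 i; lia.
Qed.

(* rev_ord (widen_ord hrs i) is the index s - 1 - i: as i runs over 'I_r, it
   runs over the r last, that is the r largest, multiplicities n. *)
Theorem proposition5p13 (K : closedFieldType) (r s : nat)
    (hr : (0 < r)%N) (hrs : (r <= s)%N)
    (lP lQ : 'rV[K]_3) (hlP : lP != 0) (hlQ : lQ != 0)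
    (P : 'I_r -> 'rV[K]_3) (Q : 'I_s -> 'rV[K]_3)
    (hPoff : forall i, off_coord_lines (P i))
    (hQoff : forall j, off_coord_lines (Q j))
    (hPline : forall i, on_line lP (P i))
    (hQline : forall j, on_line lQ (Q j))
    (hPdist : forall i k, i != k -> ~ proj_eq (P i) (P k))
    (hQdist : forall j l, j != l -> ~ proj_eq (Q j) (Q l))
    (m : 'I_r -> nat) (n : 'I_s -> nat)
    (hmpos : forall i, (0 < m i)%N) (hnpos : forall j, (0 < n j)%N)
    (hmmono : forall i k : 'I_r, (i <= k)%N -> (m i <= m k)%N)
    (hnmono : forall j l : 'I_s, (j <= l)%N -> (n j <= n l)%N)
    (hPQ : forall (i k : 'I_r) (j l : 'I_s), (i < k)%N -> (j < l)%N ->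
       ~ proj_eq (hadamard (P i) (Q j)) (hadamard (P k) (Q l)))
    (hCI : grid_complete_intersection lP lQ P Q) :
  is_alpha (hfg_ideal P m Q n)
    (\sum_(i < r) m i + \sum_(i < r) n (rev_ord (widen_ord hrs i)) - r)%N.
Proof.
have [_ _ dPQ hX] := hCI.
have hPQ0 i j : hadamard (P i) (Q j) 0 ord0 != 0 by apply: hadamard_off.
split.
  have [c c0 <-] := sum_largest hr hrs hmpos hnpos hnmono.
  pose h i := linear_form (hadamard_line lQ (P i)).
  pose v j := linear_form (hadamard_line lP (Q j)).
  exists (\prod_i h i ^+ (m i + c - 1) * \prod_j v j ^+ (n j - c)); split.
  (* Only the two lines through the point (i, j) are kept; by truncation their exponents add up to
     at least m_i + n_j - 1. *)
  - move=> i j; rewrite (bigD1 i) //= [X in _ * X](bigD1 j) //=.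
    rewrite mulrACA mulrC; apply: ideal_pow_mul.
    + by apply: linear_form_point_ideal; apply: hadamard_line_on.
    + by apply: linear_form_point_ideal; rewrite hadamardC; apply: hadamard_line_on.
    + by have := hmpos i; lia.
  - by apply: dhomogM; apply: dhomog_prod_exp => *; apply: linear_form_homog.
  - by rewrite mulf_neq0 //; apply/prodf_neq0 => i _;
      rewrite expf_neq0 // linear_form_neq0 // hadamard_line_neq0.
move=> d [F [hF dF F0]].
pose top i := rev_ord (widen_ord hrs i).
have topI : injective top.
  by move=> i j /rev_ord_inj /(congr1 val) /= /val_inj.
have hh : transversal_lines (fun i => hadamard_line lQ (P i))
    (fun i j => chart (hadamard (P i) (Q (top j)))).
  apply: (hadamard_transversal (lP := lP)) => // [i j X|i k j ik].
    by move/hX.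
  by apply: dPQ; rewrite xpair_eqE (negbTE ik).
have hv : transversal_lines (fun j => hadamard_line lP (Q (top j)))
    (fun j i => chart (hadamard (P i) (Q (top j)))).
  (* The columns are the rows of the grid with P and Q exchanged. *)
  have [i j X|j l i jl|hn hz] := hadamard_transversal (Q := P) hlP
      (fun j => hQoff (top j)) hPoff (fun j => hQline (top j)) hPline.
  - by rewrite /= hadamardC => -[hXP hXQ]; apply/hX.
  - rewrite /= ![hadamard (Q _) _]hadamardC; apply: dPQ.
    by rewrite xpair_eqE (inj_eq topI) (negbTE jl) andbF.
  by split=> // j l i; rewrite hadamardC; apply: hz.
have ho i j : order_ge (chart (hadamard (P i) (Q (top j)))) ((m i - 1) + n (top j))
    (dehom F).
  by rewrite addnBAC //; apply: order_ge_dehom.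
have := grid_degree_gt hh hv (dehom_neq0 dF F0) ho.
move/leq_trans/(_ (msize_dehom dF)); rewrite ltnS; apply: leq_trans.
(* Positivity of the m_i makes the truncated subtractions of 1 add up to that of r. *)
rewrite sumnB => [|i _]; last exact: hmpos.
rewrite sum1_card card_ord addnBAC //.
by rewrite -[X in (X <= _)%N](card_ord r) -sum1_card; apply: leq_sum.
Qed.
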